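(* Let $n=1$, write $x=x_1$, $p^j=w^j_1$ ($j=1,\dots,m$), and let $F^{jj'}=F^{j'j}$ and $F^j$ ($j,j'=1,\dots,m$) be $C^\infty$ functions of $(x,w,p)\in\mathbb R\times\mathbb R^m\times\mathbb R^m$. Consider the problem of finding a first-order $C^\infty$ function $f(x,w,p)$ on $\mathbb R\times\mathbb R^m\times\mathbb R^m$ with $$\frac{\partial^2f}{\partial p^j\partial p^{j'}}=F^{jj'},\qquad f_{w^j}-f_{p^jx}-\sum_{k}f_{p^jw^k}\,p^k=F^j\qquad(j,j'=1,\dots,m)$$ (equivalently $e^j[f]=F^j-\sum_{j'}F^{jj'}w^{j'}_2$). Define $$\Phi^{j'j}=\frac{\partial F^j}{\partial p^{j'}}+\frac{\partial F^{jj'}}{\partial x}+\sum_k\frac{\partial F^{jj'}}{\partial w^k}p^k .$$ Fix any constant vector $c=(c^1,\dots,c^m)\in\mathbb R^m$ and put $\phi^{j'j}(x,w)=\Phi^{j'j}(x,w,c)$, $\psi^j(x,w)=F^j(x,w,c)$. Then a solution $f$ exists if and only if for all $j,j',j'',k$: (a) $\partial F^{jj'}/\partial p^{j''}=\partial F^{jj''}/\partial p^{j'}$; (b) $\Phi^{j'j}+\Phi^{jj'}=0$; (c) $\partial\Phi^{j'j}/\partial p^{j''}=\partial F^{j'j''}/\partial w^j-\partial F^{jj''}/\partial w^{j'}$; (d) $\partial_{w^k}\phi^{j'j}+\partial_{w^{j'}}\phi^{jk}+\partial_{w^j}\phi^{kj'}=0$; (e) $\partial_{w^j}\psi^{j'}-\partial_{w^{j'}}\psi^j+\partial_x\phi^{j'j}+\sum_k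 c^k\partial_{w^k}\phi^{j'j}=0$. In that case, letting $\bar f$ be the unique solution of $\partial^2\bar f/\partial p^j\partial p^{j'}=F^{jj'}$ with $\bar f=\partial\bar f/\partial p^j=0$ at $p=c$, the solutions are exactly $$f=\bar f+\sum_j A^j(x,w)(p^j-c^j)+A(x,w),$$ where the $C^\infty$ functions $A^j,A$ of $(x,w)$ satisfy $$\partial_{w^j}A^{j'}-\partial_{w^{j'}}A^j=\phi^{j'j},\qquad \partial_{w^j}A=\psi^j+\partial_xA^j+\sum_k c^k\partial_{w^k}A^j\qquad(j,j'=1,\dots,m).$$
   Context: One independent variable $x$ and dependent variables $w^1,\dots,w^m$; first-order jet coordinates $p^j=w^j_1$ ($=dw^j/dx$), second-order $w^j_2$. For a first-order Lagrange function $f(x,w,p)$, $e^j[f]=f_{w^j}-\frac{d}{dx}f_{p^j}=f_{w^j}-f_{p^jx}-\sum_k f_{p^jw^k}p^k-\sum_k f_{p^jp^k}w^k_2$. (The base point $c$ is taken constant; the paper allows more general choices.) *)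

(* Defs.v *)
From Stdlib Require Import Reals ClassicalEpsilon.
From mathcomp Require Import ssreflect ssrbool eqtype ssrnat fintype bigop.
Set Implicit Arguments. Unset Strict Implicit. Unset Printing Implicit Defensive.
Open Scope R_scope.

Definition vec (m : nat) := 'I_m -> R.
Definition fun3 (m : nat) := R -> vec m -> vec m -> R.
Definition fun2 (m : nat) := R -> vec m -> R.

Definition upd (m : nat) (v : vec m) (j : 'I_m) (t : R) : vec m :=
  fun k => if k == j then t else v k.

Definition sumI (m : nat) (F : 'I_m -> R) : R := \big[Rplus/0]_(k < m) F k.

Definition deriv1 (h : R -> R) (t0 : R) : R :=
  epsilon (inhabits 0) (fun l => derivable_pt_lim h t0 l).
Definition derivable1 (h : R -> R) (t0 : R) : Prop :=
  exists l, derivable_pt_lim h t0 l.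

Definition dx3 m (g : fun3 m) : fun3 m := fun x w p => deriv1 (fun t => g t w p) x.
Definition dw3 m (j : 'I_m) (g : fun3 m) : fun3 m :=
  fun x w p => deriv1 (fun t => g x (upd w j t) p) (w j).
Definition dp3 m (j : 'I_m) (g : fun3 m) : fun3 m :=
  fun x w p => deriv1 (fun t => g x w (upd p j t)) (p j).

Definition cont3 m (g : fun3 m) : Prop :=
  forall x w p eps, 0 < eps -> exists delta, 0 < delta /\
    forall x' w' p', Rabs (x' - x) < delta -> (forall j, Rabs (w' j - w j) < delta) ->
      (forall j, Rabs (p' j - p j) < delta) -> Rabs (g x' w' p' - g x w p) < eps.

Definition partials_exist3 m (g : fun3 m) : Prop :=
  forall x w p, derivable1 (fun t => g t w p) x /\
    (forall j, derivable1 (fun t => g x (upd w j t) p) (w j)) /\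
    (forall j, derivable1 (fun t => g x w (upd p j t)) (p j)).

Fixpoint Ck3 m (k : nat) (g : fun3 m) : Prop :=
  match k with
  | O => cont3 g
  | S k' => cont3 g /\ partials_exist3 g /\ Ck3 k' (dx3 g) /\
            (forall j, Ck3 k' (dw3 j g)) /\ (forall j, Ck3 k' (dp3 j g))
  end.
Definition smooth3 m (g : fun3 m) : Prop := forall k, Ck3 k g.

Definition dx2 m (g : fun2 m) : fun2 m := fun x w => deriv1 (fun t => g t w) x.
Definition dw2 m (j : 'I_m) (g : fun2 m) : fun2 m :=
  fun x w => deriv1 (fun t => g x (upd w j t)) (w j).

Definition cont2 m (g : fun2 m) : Prop :=
  forall x w eps, 0 < eps -> exists delta, 0 < delta /\
    forall x' w', Rabs (x' - x) < delta -> (forall j, Rabs (w' j - w j) < delta) ->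
      Rabs (g x' w' - g x w) < eps.

Definition partials_exist2 m (g : fun2 m) : Prop :=
  forall x w, derivable1 (fun t => g t w) x /\
    (forall j, derivable1 (fun t => g x (upd w j t)) (w j)).

Fixpoint Ck2 m (k : nat) (g : fun2 m) : Prop :=
  match k with
  | O => cont2 g
  | S k' => cont2 g /\ partials_exist2 g /\ Ck2 k' (dx2 g) /\
            (forall j, Ck2 k' (dw2 j g))
  end.
Definition smooth2 m (g : fun2 m) : Prop := forall k, Ck2 k g.

Section Problem.
Variables (m : nat) (F2 : 'I_m -> 'I_m -> fun3 m) (F1 : 'I_m -> fun3 m) (c : vec m).

Definition is_solution (f : fun3 m) : Prop :=
  smooth3 f /\
  (forall j j' x w p, dp3 j' (dp3 j f) x w p = F2 j j' x w p) /\
  (forall j x w p, dw3 j f x w p - dx3 (dp3 j f) x w p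
                   - sumI (fun k => dw3 k (dp3 j f) x w p * p k) = F1 j x w p).

Definition Phi (j' j : 'I_m) : fun3 m :=
  fun x w p => dp3 j' (F1 j) x w p + dx3 (F2 j j') x w p
               + sumI (fun k => dw3 k (F2 j j') x w p * p k).

Definition phi (j' j : 'I_m) : fun2 m := fun x w => Phi j' j x w c.
Definition psi (j : 'I_m) : fun2 m := fun x w => F1 j x w c.

Definition conditions : Prop :=
  (* (a) *) (forall j j' j'' x w p, dp3 j'' (F2 j j') x w p = dp3 j' (F2 j j'') x w p) /\
  (* (b) *) (forall j j' x w p, Phi j' j x w p + Phi j j' x w p = 0) /\
  (* (c) *) (forall j j' j'' x w p,
               dp3 j'' (Phi j' j) x w p = dw3 j (F2 j' j'') x w p - dw3 j' (F2 j j'') x w p) /\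
  (* (d) *) (forall j j' k x w,
               dw2 k (phi j' j) x w + dw2 j' (phi j k) x w + dw2 j (phi k j') x w = 0) /\
  (* (e) *) (forall j j' x w,
               dw2 j (psi j') x w - dw2 j' (psi j) x w + dx2 (phi j' j) x w
               + sumI (fun k => c k * dw2 k (phi j' j) x w) = 0).

Definition is_fbar (fb : fun3 m) : Prop :=
  smooth3 fb /\
  (forall j j' x w p, dp3 j' (dp3 j fb) x w p = F2 j j' x w p) /\
  (forall x w, fb x w c = 0) /\
  (forall j x w, dp3 j fb x w c = 0).

Definition of_stated_form (fb f : fun3 m) : Prop :=
  exists (A1 : 'I_m -> fun2 m) (A : fun2 m),
    (forall j, smooth2 (A1 j)) /\ smooth2 A /\
    (forall j j' x w, dw2 j (A1 j') x w - dw2 j' (A1 j) x w = phi j' j x w) /\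
    (forall j x w, dw2 j A x w =
        psi j x w + dx2 (A1 j) x w + sumI (fun k => c k * dw2 k (A1 j) x w)) /\
    (forall x w p, f x w p = fb x w p + sumI (fun j => A1 j x w * (p j - c j)) + A x w).

End Problem.

(* Main.v *)
(** The Poincare lemma drives everything. Scaling the coordinates of a subset [S]
towards a base point gives weighted cone integrals
[cone a g v = \int_0^1 t^a g(shrink t v) dt], which commute with partial derivatives up
to the weight and satisfy an Euler identity; this yields primitives, smooth in the
remaining coordinates, of closed 1-forms and 2-forms in the [S]-directions.

Put [a_j = f_{p^j}]. For a solution [f], differentiating the Euler equation in [p^i]
gives [Phi^{ij} = d_{w^j} a_i - d_{w^i} a_j], whence the conditions (a)-(e).
Conversely, (a) gives [fbar] by two successive primitives in [p]; (b) and (d) make [phi] a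
closed 2-form in [w], whose primitive is the [A^j]; (e) closes the 1-form defining [A].
For [f] of the stated form, the defect in the Euler equation vanishes because
its second [p]-derivatives vanish by (c), while the defect and its first [p]-derivatives
vanish at [p = c] by the equations for [A] and [A^j]. *)
Require Import Defs.
From HB Require Import structures.
From Stdlib Require Import Reals Lra ClassicalEpsilon FunctionalExtensionality.
From mathcomp Require Import ssreflect ssrfun ssrbool eqtype ssrnat seq fintype bigop.
From Coquelicot Require Import Coquelicot.
Set Implicit Arguments. Unset Strict Implicit. Unset Printing Implicit Defensive.
Open Scope R_scope.

(** * Finite real sums and limits along filters *)

Lemma Rplus_associative : associative Rplus. Proof. move=> x y z; ring. Qed.
Lemma Rplus_commutative : commutative Rplus. Proof. move=> x y; ring. Qed.
Lemma Rplus_left_id : left_id 0 Rplus. Proof. move=> x; ring. Qed.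
(** Makes the general lemmas on iterated operations apply to the sums of [sumI]. *)
HB.instance Definition _ :=
  Monoid.isComLaw.Build R 0 Rplus Rplus_associative Rplus_commutative Rplus_left_id.

Notation "\bigsum_ i F" := (\big[Rplus/0]_i F)
  (at level 41, i at level 0, F at level 41, only parsing).

Lemma bigsum_mull (I : finType) (F : I -> R) c :
  c * (\bigsum_i F i) = \bigsum_i (c * F i).
Proof. by apply: (big_morph (fun x => c * x)) => [x y|]; ring. Qed.

Lemma bigsum_opp (I : finType) (F : I -> R) :
  - (\bigsum_i F i) = \bigsum_i (- F i).
Proof. by apply: (big_morph Ropp) => [x y|]; ring. Qed.

Lemma bigsum_add (I : finType) (F G : I -> R) :
  \bigsum_i (F i + G i) = (\bigsum_i F i) + \bigsum_i G i.
Proof. exact: big_split. Qed.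

Lemma bigsum_sub (I : finType) (F G : I -> R) :
  \bigsum_i (F i - G i) = (\bigsum_i F i) - \bigsum_i G i.
Proof. by rewrite /Rminus bigsum_opp -bigsum_add. Qed.

Lemma bigsum_delta (I : finType) (F : I -> R) j :
  \bigsum_i (F i * (if i == j then 1 else 0)) = F j.
Proof.
rewrite (bigD1 j) //= eqxx big1 ?Rplus_0_r ?Rmult_1_r // => i /negbTE ->.
exact: Rmult_0_r.
Qed.

Lemma finite_bound (I : finType) (q : I -> R) :
  exists M, 0 < M /\ forall i, Rabs (q i) <= M.
Proof.
have [M [M0 HM]] : exists M, 0 < M /\ forall i, i \in enum I -> Rabs (q i) <= M.
  elim: (enum I) => [|i s [M [M0 HM]]]; first by exists 1; split=> //; lra.
  exists (Rmax M (Rabs (q i))); split=> [|k].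
    exact: Rlt_le_trans M0 (Rmax_l _ _).
  rewrite inE => /orP[/eqP->|/HM H]; first exact: Rmax_r.
  exact: Rle_trans H (Rmax_l _ _).
by exists M; split=> // i; apply: HM; rewrite mem_enum.
Qed.

Lemma filter_finite_forall (I : finType) T (F : (T -> Prop) -> Prop)
    {FF : Filter F} (P : I -> T -> Prop) :
  (forall i, F (P i)) -> F (fun x => forall i, P i x).
Proof.
move=> H.
suff : F (fun x => forall i, i \in enum I -> P i x).
  by apply: filter_imp => x Hx i; apply: Hx; rewrite mem_enum.
elim: (enum I) => [|i s IH]; first by apply: filter_imp filter_true.
apply: filter_imp (filter_and _ _ (H i) IH) => x [Hi Hs] k.
by rewrite inE => /orP[/eqP->|/Hs].
Qed.

Lemma filterlim_Rplus T (F : (T -> Prop) -> Prop) {FF : Filter F} (f g : T -> R) a b :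
  filterlim f F (locally a) -> filterlim g F (locally b) ->
  filterlim (fun x => f x + g x) F (locally (a + b)).
Proof.
by move=> Hf Hg; apply: filterlim_comp_2 Hf Hg (@filterlim_plus _ R_NormedModule a b).
Qed.

Lemma filterlim_Rmult T (F : (T -> Prop) -> Prop) {FF : Filter F} (f g : T -> R) a b :
  filterlim f F (locally a) -> filterlim g F (locally b) ->
  filterlim (fun x => f x * g x) F (locally (a * b)).
Proof.
by move=> Hf Hg; apply: filterlim_comp_2 Hf Hg (@filterlim_mult R_AbsRing a b).
Qed.

(** * Differential calculus on a finite coordinate set *)

Section Calculus.
Variable I : finType.
Implicit Types (g h : (I -> R) -> R) (v : I -> R) (i j : I) (k : nat).

Definition setc v i (t : R) : I -> R := fun l => if l == i then t else v l.

Lemma setc_same v i t : setc v i t i = t.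
Proof. by rewrite /setc eqxx. Qed.

Lemma setc_id v i : setc v i (v i) = v.
Proof. by apply: functional_extensionality => l; rewrite /setc; case: eqP => [->|]. Qed.

Lemma setc_setc v i s t : setc (setc v i s) i t = setc v i t.
Proof. by apply: functional_extensionality => l; rewrite /setc; case: eqP. Qed.

Lemma setc_comm v i j s t : i != j ->
  setc (setc v i s) j t = setc (setc v j t) i s.
Proof.
move=> ij; apply: functional_extensionality => l; rewrite /setc.
by case: (l =P j) => // ->; rewrite eq_sym (negbTE ij).
Qed.

Definition pd i g : (I -> R) -> R :=
  fun v => deriv1 (fun t => g (setc v i t)) (v i).

(** Because [deriv1] returns an unspecified value where no derivative exists, derivatives are
    computed with this relation and carried over to [pd] by [is_pd_unique]. *)
Definition is_pd i g g' :=
  forall v, is_derive (fun t => g (setc v i t)) (v i) (g' v).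

Lemma deriv1_unique (f : R -> R) t l : is_derive f t l -> deriv1 f t = l.
Proof.
move=> /is_derive_Reals H; rewrite /deriv1.
have H' := epsilon_spec (inhabits 0) (fun l => derivable_pt_lim f t l) (ex_intro _ l H).
exact: uniqueness_limite H' H.
Qed.

Lemma is_pd_unique i g g' : is_pd i g g' -> pd i g = g'.
Proof. by move=> H; apply: functional_extensionality => v; apply: deriv1_unique. Qed.

Lemma is_pd_at i g g' v t : is_pd i g g' ->
  is_derive (fun s => g (setc v i s)) t (g' (setc v i t)).
Proof.
move/(_ (setc v i t)); rewrite setc_same.
by apply: is_derive_ext => s; rewrite setc_setc.
Qed.

(** The product topology through sup-norm balls, so that [cont] unfolds to the epsilon-delta form of
    [cont3]. *)
Definition near v (P : (I -> R) -> Prop) :=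
  exists d : posreal, forall v', (forall i, Rabs (v' i - v i) < d) -> P v'.

Global Instance near_filter v : Filter (near v).
Proof.
split.
- by exists (mkposreal 1 Rlt_0_1).
- move=> P Q [d1 H1] [d2 H2].
  have d0 : 0 < Rmin d1 d2 by apply: Rmin_pos; apply: cond_pos.
  exists (mkposreal _ d0) => v' /= H; split.
    by apply: H1 => i; apply: Rlt_le_trans (H i) (Rmin_l _ _).
  by apply: H2 => i; apply: Rlt_le_trans (H i) (Rmin_r _ _).
- by move=> P Q PQ [d H]; exists d => v' Hv; apply/PQ/H.
Qed.

Lemma filterlim_near T (F : (T -> Prop) -> Prop) {FF : Filter F} (u : T -> I -> R) v :
  (forall i, filterlim (fun x => u x i) F (locally (v i))) -> filterlim u F (near v).
Proof.
move=> H P [d HP]; rewrite /filtermap.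
have : F (fun x => forall i, Rabs (u x i - v i) < d).
  apply: filter_finite_forall => i.
  by apply: (H i (fun y => Rabs (y - v i) < d)); exists d => y.
by apply: filter_imp => x; apply: HP.
Qed.

Lemma filterlim_coord v i : filterlim (fun v' => v' i) (near v) (locally (v i)).
Proof. by move=> P [d HP]; exists d => v' Hv; apply: HP; apply: Hv. Qed.

Definition cont g := forall v, filterlim g (near v) (locally (g v)).

Fixpoint Ck k g : Prop :=
  match k with
  | O => cont g
  | S k' => cont g /\ (forall i v, derivable1 (fun t => g (setc v i t)) (v i)) /\
            forall i, Ck k' (pd i g)
  end.

Definition smooth g := forall k, Ck k g.

Lemma Ck_cont k g : Ck k g -> cont g.
Proof. by case: k => [|k] //= [].  Qed.

Lemma smooth_cont g : smooth g -> cont g.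
Proof. by move=> /(_ O). Qed.

Lemma CkS_is_pd k g i : Ck k.+1 g -> is_pd i g (pd i g).
Proof.
move=> [_ [H _]] v; have [l /is_derive_Reals Hl] := H i v.
by rewrite /pd (deriv1_unique Hl).
Qed.

Lemma CkS_intro k g (g' : I -> (I -> R) -> R) : cont g ->
  (forall i, is_pd i g (g' i)) -> (forall i, Ck k (g' i)) -> Ck k.+1 g.
Proof.
move=> cg Hg Hk; split=> //; split=> i; last by rewrite (is_pd_unique (Hg i)).
by move=> v; exists (g' i v); apply/is_derive_Reals/Hg.
Qed.

Lemma CkS_pd k g i : Ck k.+1 g -> Ck k (pd i g).
Proof. by move=> [_ [_ H]]; apply: H. Qed.

Lemma CkS_Ck k g : Ck k.+1 g -> Ck k g.
Proof.
elim: k g => [|k IH] g; first by case.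
move=> H; apply: (@CkS_intro k g (fun i => pd i g)).
- exact: Ck_cont H.
- by move=> i; apply: CkS_is_pd H.
- by move=> i; apply: IH; apply: CkS_pd H.
Qed.

Lemma smooth_is_pd g i : smooth g -> is_pd i g (pd i g).
Proof. by move=> H; apply: CkS_is_pd (H 1%N). Qed.

Lemma smooth_pd i g : smooth g -> smooth (pd i g).
Proof. by move=> H k; apply: CkS_pd (H k.+1). Qed.

Lemma cont_const a : cont (fun _ => a).
Proof. by move=> v; apply: filterlim_const. Qed.

Lemma cont_add g h : cont g -> cont h -> cont (fun v => g v + h v).
Proof. by move=> cg ch v; apply: filterlim_Rplus. Qed.

Lemma cont_mul g h : cont g -> cont h -> cont (fun v => g v * h v).
Proof. by move=> cg ch v; apply: filterlim_Rmult. Qed.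

Lemma is_pd_const i a : is_pd i (fun _ => a) (fun _ => 0).
Proof. by move=> v; apply: is_derive_const. Qed.

Lemma is_pd_coord i j : is_pd i (fun v => v j) (fun _ => if j == i then 1 else 0).
Proof.
move=> v; rewrite /setc; case: eqP => _; first exact: (@is_derive_id R_AbsRing).
exact: is_derive_const.
Qed.

Lemma is_pd_add i g h g' h' : is_pd i g g' -> is_pd i h h' ->
  is_pd i (fun v => g v + h v) (fun v => g' v + h' v).
Proof. by move=> Hg Hh v; apply: (@is_derive_plus _ R_NormedModule). Qed.

Lemma is_pd_mul i g h g' h' : is_pd i g g' -> is_pd i h h' ->
  is_pd i (fun v => g v * h v) (fun v => g' v * h v + g v * h' v).
Proof.
move=> Hg Hh v.
have := @is_derive_mult R_AbsRing _ _ _ _ _ (Hg v) (Hh v) Rmult_comm.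
by rewrite !setc_id.
Qed.

Lemma Ck_const k a : Ck k (fun _ => a).
Proof.
elim: k a => [|k IH] a; first exact: cont_const.
by apply: CkS_intro => [|i|i]; [apply: cont_const|apply: is_pd_const|].
Qed.

Lemma Ck_add k g h : Ck k g -> Ck k h -> Ck k (fun v => g v + h v).
Proof.
elim: k g h => [|k IH] g h Hg Hh; first exact: cont_add.
apply: CkS_intro => [|i|i].
- by apply: cont_add; [apply: Ck_cont Hg|apply: Ck_cont Hh].
- by apply: is_pd_add; [apply: CkS_is_pd Hg|apply: CkS_is_pd Hh].
- by apply: IH; apply: CkS_pd.
Qed.

Lemma Ck_mul k g h : Ck k g -> Ck k h -> Ck k (fun v => g v * h v).
Proof.
elim: k g h => [|k IH] g h Hg Hh; first exact: cont_mul.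
apply: CkS_intro => [|i|i].
- by apply: cont_mul; [apply: Ck_cont Hg|apply: Ck_cont Hh].
- by apply: is_pd_mul; [apply: CkS_is_pd Hg|apply: CkS_is_pd Hh].
- by apply: Ck_add; apply: IH; by [apply: CkS_pd|apply: CkS_Ck].
Qed.

Lemma smooth_const a : smooth (fun _ => a).
Proof. by move=> k; apply: Ck_const. Qed.

Lemma smooth_coord j : smooth (fun v => v j).
Proof.
case=> [|k]; first by move=> v; apply: filterlim_coord.
apply: CkS_intro => [v|i|i]; [exact: filterlim_coord|exact: is_pd_coord|].
exact: Ck_const.
Qed.

Lemma smooth_add g h : smooth g -> smooth h -> smooth (fun v => g v + h v).
Proof. by move=> Hg Hh k; apply: Ck_add. Qed.

Lemma smooth_mul g h : smooth g -> smooth h -> smooth (fun v => g v * h v).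
Proof. by move=> Hg Hh k; apply: Ck_mul. Qed.

Lemma smooth_sub g h : smooth g -> smooth h -> smooth (fun v => g v - h v).
Proof.
move=> Hg Hh.
have -> : (fun v => g v - h v) = (fun v => g v + (-1) * h v).
  by apply: functional_extensionality => v; ring.
by apply: smooth_add => //; apply: smooth_mul => //; apply: smooth_const.
Qed.

Lemma smooth_sum (J : finType) (G : J -> (I -> R) -> R) :
  (forall l, smooth (G l)) -> smooth (fun v => \bigsum_l G l v).
Proof.
move=> H; rewrite unlock /=; elim: (index_enum J) => [|l s IH] /=.
  exact: smooth_const.
exact: smooth_add.
Qed.

Lemma pd_const i a : pd i (fun _ => a) = fun _ => 0.
Proof. exact/is_pd_unique/is_pd_const. Qed.

Lemma pd_coord i j : pd i (fun v => v j) = fun _ => if j == i then 1 else 0.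
Proof. exact/is_pd_unique/is_pd_coord. Qed.

Lemma pd_add i g h : smooth g -> smooth h ->
  pd i (fun v => g v + h v) = fun v => pd i g v + pd i h v.
Proof. by move=> Hg Hh; apply/is_pd_unique/is_pd_add; apply: smooth_is_pd. Qed.

Lemma pd_mul i g h : smooth g -> smooth h ->
  pd i (fun v => g v * h v) = fun v => pd i g v * h v + g v * pd i h v.
Proof. by move=> Hg Hh; apply/is_pd_unique/is_pd_mul; apply: smooth_is_pd. Qed.

Lemma pd_sub i g h : smooth g -> smooth h ->
  pd i (fun v => g v - h v) = fun v => pd i g v - pd i h v.
Proof.
move=> Hg Hh.
have -> : (fun v => g v - h v) = (fun v => g v + (-1) * h v).
  by apply: functional_extensionality => v; ring.
have c1 := smooth_const (-1).
rewrite pd_add ?pd_mul ?pd_const //; last exact: smooth_mul.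
by apply: functional_extensionality => v; ring.
Qed.

Lemma pd_sum i (J : finType) (G : J -> (I -> R) -> R) :
  (forall l, smooth (G l)) ->
  pd i (fun v => \bigsum_l G l v) = fun v => \bigsum_l pd i (G l) v.
Proof.
move=> H; apply: is_pd_unique; rewrite unlock /=.
elim: (index_enum J) => [|l s IH] /=; first exact: is_pd_const.
by apply: is_pd_add => //; apply: smooth_is_pd.
Qed.

Lemma filterlim_setc2 v i j s t :
  filterlim (fun z : R * R => setc (setc v i (fst z)) j (snd z))
    (locally (s, t)) (near (setc (setc v i s) j t)).
Proof.
apply: filterlim_near => l; rewrite /setc.
case: (l =P j) => _; first exact: (@continuous_snd R_UniformSpace R_UniformSpace).
case: (l =P i) => _; first exact: (@continuous_fst R_UniformSpace R_UniformSpace).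
exact: filterlim_const.
Qed.

(** Schwarz's theorem in two variables, applied to the restriction of [g] to the plane through [v]
    in the directions [i] and [j]; smoothness makes both mixed partials continuous on that plane. *)
Lemma pd_comm i j g : smooth g -> pd i (pd j g) = pd j (pd i g).
Proof.
move=> Hg; case: (eqVneq i j) => [->//|ij].
apply: functional_extensionality => v.
pose f s t := g (setc (setc v i s) j t).
have f1 s t : is_derive (fun z => f z t) s (pd i g (setc (setc v i s) j t)).
  rewrite (setc_comm _ _ _ ij).
  apply: is_derive_ext (is_pd_at (setc v j t) s (smooth_is_pd i Hg)) => z.
  by rewrite /f (setc_comm _ _ _ ij).
have f2 s t : is_derive (f s) t (pd j g (setc (setc v i s) j t)).
  exact: is_pd_at (smooth_is_pd j Hg).
have f12 s t : is_derive (fun z => Derive (f z) t) s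
    (pd i (pd j g) (setc (setc v i s) j t)).
  rewrite (setc_comm _ _ _ ij).
  apply: is_derive_ext (is_pd_at (setc v j t) s (smooth_is_pd i (smooth_pd j Hg))).
  by move=> z; rewrite (is_derive_unique _ _ _ (f2 z t)) (setc_comm _ _ _ ij).
have f21 s t : is_derive (fun z => Derive (fun y => f y z) s) t
    (pd j (pd i g) (setc (setc v i s) j t)).
  apply: is_derive_ext (is_pd_at _ t (smooth_is_pd j (smooth_pd i Hg))).
  by move=> z; rewrite (is_derive_unique _ _ _ (f1 s z)).
have E12 s t := is_derive_unique _ _ _ (f12 s t).
have E21 s t := is_derive_unique _ _ _ (f21 s t).
have cpt h : smooth h ->
    continuity_2d_pt (fun s t => h (setc (setc v i s) j t)) (v i) (v j).
  move=> Hh; apply/continuity_2d_pt_filterlim.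
  exact: (filterlim_comp _ _ _ _ h _ _ _ (@filterlim_setc2 v i j (v i) (v j))
    (@smooth_cont h Hh _)).
have := @Schwarz f (v i) (v j).
rewrite E12 E21 !setc_id => -> //.
- by exists (mkposreal 1 Rlt_0_1) => s t _ _; split; [|split; [|split]];
    eexists; [exact: f1|exact: f2|exact: f12|exact: f21].
- apply: continuity_2d_pt_ext (cpt _ (smooth_pd i (smooth_pd j Hg))) => s t.
  by rewrite E12.
- apply: continuity_2d_pt_ext (cpt _ (smooth_pd j (smooth_pd i Hg))) => s t.
  by rewrite E21.
Qed.

End Calculus.

(** * Cone integrals and the Poincare lemma *)

Lemma filterlim_bigsum (J : finType) T (F : (T -> Prop) -> Prop) {FF : Filter F}
    (f : J -> T -> R) (a : J -> R) :
  (forall j, filterlim (f j) F (locally (a j))) ->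
  filterlim (fun x => \bigsum_j f j x) F (locally (\bigsum_j a j)).
Proof.
move=> H; rewrite unlock /=; elim: (index_enum J) => [|j s IH] /=.
  exact: filterlim_const.
exact: filterlim_Rplus.
Qed.

Lemma is_RInt_bigsum (J : finType) (f : J -> R -> R) (y : J -> R) a b :
  (forall j, is_RInt (f j) a b (y j)) ->
  is_RInt (fun x => \bigsum_j f j x) a b (\bigsum_j y j).
Proof.
move=> H; rewrite unlock /=; elim: (index_enum J) => [|j s IH] /=.
  have := @is_RInt_const R_NormedModule a b 0.
  by rewrite /scal /= /mult /= Rmult_0_r.
exact: (@is_RInt_plus R_NormedModule).
Qed.

Section Homotopy.
Variable I : finType.
Implicit Types (g h : (I -> R) -> R) (v q : I -> R) (i j : I) (k a : nat).

Lemma between_bound (x0 x1 y : R) : Rmin x0 x1 <= y <= Rmax x0 x1 ->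
  Rabs (y - x0) <= Rabs (x1 - x0).
Proof.
rewrite /Rmin /Rmax; case: Rle_dec => H [H1 H2].
  by rewrite !Rabs_pos_eq; lra.
rewrite Rabs_minus_sym (Rabs_minus_sym x1) !Rabs_pos_eq; lra.
Qed.

(* The coordinates in [s] move while the others stay frozen at time [t]; adding
   them one at a time reduces the chain rule to the mean value theorem. *)
Let path (s : seq I) v q t t' : I -> R :=
  fun i => if i \in s then v i + t' * q i else v i + t * q i.

Lemma is_derive_path (s : seq I) g v q t : uniq s -> smooth g ->
  is_derive (fun t' => g (path s v q t t')) t
    (\big[Rplus/0]_(i <- s) (q i * pd i g (fun i => v i + t * q i))).
Proof.
move=> + Hg; elim: s => [_|i s IH] /=.
  by rewrite big_nil; apply: (is_derive_ext (fun _ => g (fun i => v i + t * q i)));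
    last exact: is_derive_const.
case/andP=> is_ /IH {}IH; rewrite big_cons.
set L := fun i => v i + t * q i.
(* The increment in the single coordinate [i] is split off; the remaining summand is the induction
   hypothesis. *)
apply: (is_derive_ext (fun t' => (g (path (i :: s) v q t t') - g (path s v q t t'))
   + g (path s v q t t'))); first by move=> t' /=; rewrite /Rminus; lra.
apply: (@is_derive_plus R_AbsRing R_NormedModule) => //.
have pathi t' : path (i :: s) v q t t' = setc (path s v q t t') i (v i + t' * q i).
  apply: functional_extensionality => l; rewrite /path /setc inE.
  by case: (l =P i) => [->|].
apply/is_derive_Reals => eps eps0.
(* [M] bounds all the speeds [q]: an increment of [t] below [d / M] keeps the intermediate points
   within [d] of [L], and an error [eps / M] in the partial derivative, multiplied by [q i], stays
   below [eps]. *)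
have [M [M0 HM]] := finite_bound q.
have e0 : 0 < eps / M by apply: Rdiv_lt_0_compat.
have [d Hd] : near L (fun w => Rabs (pd i g w - pd i g L) < eps / M).
  apply: (@smooth_cont I _ (smooth_pd i Hg) L (fun y => Rabs (y - pd i g L) < eps / M)).
  by exists (mkposreal _ e0).
have d0 : 0 < d / M by apply: Rdiv_lt_0_compat M0; apply: cond_pos.
exists (mkposreal _ d0) => x x0 /= xd.
have -> : path (i :: s) v q t t = path s v q t t.
  by apply: functional_extensionality => l; rewrite /path !if_same.
rewrite pathi; set P := path s v q t (t + x).
have Pi : P i = v i + t * q i by rewrite /P /path (negbTE is_).
have [y [Hy]] := @MVT_gen (fun z => g (setc P i z)) (P i) (v i + (t + x) * q i)
  (fun z => pd i g (setc P i z)) (fun z _ => is_pd_at P z (smooth_is_pd i Hg))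
  (fun z _ => proj2 (continuity_pt_filterlim _ _)
     (ex_derive_continuous _ _ (ex_intro _ _ (is_pd_at P z (smooth_is_pd i Hg))))).
rewrite setc_id => ->.
have Mxd : M * Rabs x < d.
  rewrite Rmult_comm; have := Rmult_lt_compat_r M _ _ M0 xd.
  by have -> : d / M * M = d by field; lra.
have xq l : Rabs (x * q l) < d.
  apply: Rle_lt_trans Mxd; rewrite Rabs_mult Rmult_comm.
  by apply: Rmult_le_compat_r => //; apply: Rabs_pos.
have close : Rabs (pd i g (setc P i y) - pd i g L) < eps / M.
  apply: Hd => l; rewrite /setc; case: (l =P i) => [->|_].
    have := between_bound Hy; rewrite Pi /L => H.
    apply: Rle_lt_trans H _.
    by have -> : v i + (t + x) * q i - (v i + t * q i) = x * q i by ring.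
  rewrite /P /path /L; case: (l \in s).
    by have -> : v l + (t + x) * q l - (v l + t * q l) = x * q l by ring.
  by rewrite Rminus_diag Rabs_R0; apply: cond_pos.
rewrite Pi.
have -> : (pd i g (setc P i y) * (v i + (t + x) * q i - (v i + t * q i))
    - (g (path s v q t t) - g (path s v q t t))) / x - q i * pd i g L
   = q i * (pd i g (setc P i y) - pd i g L) by field.
rewrite Rabs_mult.
apply: (@Rle_lt_trans _ (M * Rabs (pd i g (setc P i y) - pd i g L))).
  by apply: Rmult_le_compat_r => //; apply: Rabs_pos.
have := Rmult_lt_compat_l M _ _ M0 close.
by have -> : M * (eps / M) = eps by field; lra.
Qed.

Lemma is_derive_line g v q t : smooth g ->
  is_derive (fun s => g (fun i => v i + s * q i)) t
    (\bigsum_i (q i * pd i g (fun i => v i + t * q i))).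
Proof.
move=> /(is_derive_path v q t (index_enum_uniq I)).
apply: is_derive_ext => s; congr g; apply: functional_extensionality => i.
by rewrite /path mem_index_enum.
Qed.

Variables (S : pred I) (c : I -> R).

Definition shrink t v : I -> R := fun i => if S i then c i + t * (v i - c i) else v i.

(** The velocity of [shrink t v] in [t], that is, the Euler vector field of the [S]-directions
    centred at [c]. *)
Definition radial v : I -> R := fun i => if S i then v i - c i else 0.

Lemma shrink1 v : shrink 1 v = v.
Proof. by apply: functional_extensionality => i; rewrite /shrink; case: (S i); lra. Qed.

Lemma is_derive_shrink g v t : smooth g ->
  is_derive (fun s => g (shrink s v)) t (\bigsum_i (radial v i * pd i g (shrink t v))).
Proof.
move=> Hg.
have E s : shrink s v = (fun i => shrink 0 v i + s * radial v i).
  apply: functional_extensionality => i; rewrite /shrink /radial.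
  by case: (S i); lra.
rewrite E; apply: is_derive_ext (is_derive_line (shrink 0 v) (radial v) t Hg).
by move=> s; rewrite (E s).
Qed.

Lemma shrink_setc t v i s :
  shrink t (setc v i s) =
  setc (shrink t v) i (if S i then c i + t * (s - c i) else s).
Proof.
apply: functional_extensionality => l; rewrite /shrink /setc.
by case: (l =P i) => [->|].
Qed.

Lemma filterlim_shrink t v :
  filterlim (fun z => shrink (fst z) (snd z)) (filter_prod (locally t) (near v))
    (near (shrink t v)).
Proof.
apply: filterlim_near => i; rewrite /shrink.
have Hv : filterlim (fun z : R * (I -> R) => snd z i)
    (filter_prod (locally t) (near v)) (locally (v i)).
  exact: filterlim_comp filterlim_snd (@filterlim_coord I v i).
case: (S i) => //.
apply: filterlim_Rplus; first exact: filterlim_const.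
apply: filterlim_Rmult; first exact: filterlim_fst.
by apply: filterlim_Rplus => //; apply: filterlim_const.
Qed.

Definition cone a g v := RInt (fun t => t ^ a * g (shrink t v)) 0 1.

Lemma continuous_integrand a g v t : cont g ->
  continuous (fun t => t ^ a * g (shrink t v)) t.
Proof.
move=> Hg; apply: (@continuous_mult _ R_AbsRing (fun t => t ^ a)).
  by apply: ex_derive_continuous; auto_derive.
apply: filterlim_comp (Hg _); apply: filterlim_near => i; rewrite /shrink.
case: (S i); last exact: filterlim_const.
by apply: (@ex_derive_continuous R_AbsRing R_NormedModule); auto_derive.
Qed.

Lemma ex_RInt_integrand a g v : cont g ->
  ex_RInt (fun t => t ^ a * g (shrink t v)) 0 1.
Proof. by move=> Hg; apply: ex_RInt_continuous => t _; apply: continuous_integrand. Qed.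

Lemma pow_unit_bound a t : 0 <= t <= 1 -> Rabs (t ^ a) <= 1.
Proof.
move=> Ht; rewrite -RPow_abs -(pow1 a); apply: pow_incr; split; first exact: Rabs_pos.
by rewrite Rabs_pos_eq; lra.
Qed.

(** Continuity of [g] gives a modulus at each [t]; compactness of the unit interval makes it uniform
    in [t], so the integrands at [v'] and [v] differ uniformly by at most [eps / 2]. *)
Lemma cont_cone a g : cont g -> cont (cone a g).
Proof.
move=> Hg v P [eps HP].
have e4 : 0 < eps / 4 by have := cond_pos eps; lra.
have Hloc t : exists d : posreal, forall t' v', Rabs (t' - t) < d ->
    (forall i, Rabs (v' i - v i) < d) ->
    Rabs (g (shrink t' v') - g (shrink t v)) < eps / 4.
  have [|Q1 Q2 [d1 H1] [d2 H2] H] := filterlim_comp _ _ _ _ _ _ _ _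
    (@filterlim_shrink t v) (Hg (shrink t v))
    (fun y => Rabs (y - g (shrink t v)) < eps / 4).
    by exists (mkposreal _ e4).
  have d0 : 0 < Rmin d1 d2 by apply: Rmin_pos; apply: cond_pos.
  exists (mkposreal _ d0) => t' v' /= Ht Hv; apply: H.
    by apply: H1; apply: Rlt_le_trans Ht (Rmin_l _ _).
  by apply: H2 => i; apply: Rlt_le_trans (Hv i) (Rmin_r _ _).
pose delta t := proj1_sig (constructive_indefinite_description _ (Hloc t)).
have [d Hd] := compactness_value_1d 0 1 delta.
exists d => v' Hv; apply: HP.
have bound t : 0 <= t <= 1 ->
    Rabs (t ^ a * g (shrink t v') - t ^ a * g (shrink t v)) <= eps / 2.
  move=> Ht; rewrite -Rmult_minus_distr_l Rabs_mult.
  apply: (Rle_trans _ (1 * Rabs (g (shrink t v') - g (shrink t v)))).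
    by apply: Rmult_le_compat_r; [apply: Rabs_pos|apply: pow_unit_bound].
  (* Compactness delivers the centre [s] only under a double negation. Both values of [g] are
     compared with the one at [shrink s v], at a cost of [eps / 4] each. *)
  have [s [Hs [ts ds]]] := NNPP _ (Hd t Ht).
  have Hdelta := proj2_sig (constructive_indefinite_description _ (Hloc s)).
  have A1 := Hdelta t v' ts (fun i => Rlt_le_trans _ _ _ (Hv i) ds).
  have A2 := Hdelta t v ts (fun i => _).
  have {}A2 : Rabs (g (shrink t v) - g (shrink s v)) < eps / 4.
    apply: A2 => i; rewrite Rminus_diag Rabs_R0; exact: cond_pos.
  rewrite Rabs_minus_sym in A2.
  move: A1 A2; rewrite /Rabs; do 3 case: Rcase_abs => ?; lra.
have Ig w := ex_RInt_integrand a w Hg.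
have : Rabs (RInt (fun t => t ^ a * g (shrink t v') - t ^ a * g (shrink t v)) 0 1)
    <= (1 - 0) * (eps / 2).
  apply: abs_RInt_le_const => //; first lra.
  exact: (@ex_RInt_minus R_NormedModule).
rewrite (@RInt_minus R_CompleteNormedModule) // => H.
apply: Rle_lt_trans H _; have := cond_pos eps; lra.
Qed.

(** Differentiation under the integral sign. By the chain rule a derivative in an [S]-direction
    brings out a factor [t] and any other derivative brings out [1]; hence the exponent grows by the
    boolean [S i] read as a number. *)
Lemma is_pd_cone a g i : smooth g ->
  is_pd i (cone a g) (cone (a + S i) (pd i g)).
Proof.
move=> Hg v.
pose D s t := t ^ (a + S i) * pd i g (shrink t (setc v i s)).
have HD s t : is_derive (fun s => t ^ a * g (shrink t (setc v i s))) s (D s t).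
  apply: (is_derive_ext (fun s => t ^ a *
    g (setc (shrink t v) i (if S i then c i + t * (s - c i) else s)))).
    by move=> s'; rewrite shrink_setc.
  rewrite /D shrink_setc.
  have -> : t ^ (a + S i) = t ^ a * (if S i then t else 1).
    by case: (S i); rewrite ?addn1 ?addn0 /=; ring.
  rewrite Rmult_assoc; apply: is_derive_scal.
  apply: (@is_derive_comp R_AbsRing R_NormedModule
    (fun s => g (setc (shrink t v) i s))).
    exact: is_pd_at (smooth_is_pd i Hg).
  by case: (S i); auto_derive => //; ring.
have ED s t := is_derive_unique _ _ _ (HD s t).
have := @is_derive_RInt_param (fun s t => t ^ a * g (shrink t (setc v i s))) 0 1 (v i).
have -> : RInt (fun t => Derive (fun s => t ^ a * g (shrink t (setc v i s))) (v i)) 0 1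
    = cone (a + S i) (pd i g) v.
  by apply: RInt_ext => t _; rewrite ED /D setc_id.
apply.
- by apply: filter_forall => s t _; exists (D s t).
- move=> t _.
  apply: (continuity_2d_pt_ext D) => [s u|]; first by rewrite ED.
  apply/continuity_2d_pt_filterlim.
  apply: filterlim_Rmult.
    apply: (filterlim_comp _ _ _ snd (fun t => t ^ (a + S i)) _ (locally t)).
      exact: (@continuous_snd R_UniformSpace R_UniformSpace).
    by apply: (@ex_derive_continuous R_AbsRing R_NormedModule); auto_derive.
  apply: (filterlim_comp _ _ _ (fun z => shrink (snd z) (setc v i (fst z))) (pd i g) _
    (near (shrink t (setc v i (v i))))); last exact: (smooth_cont (smooth_pd i Hg)).
  apply: (@filterlim_comp_2 _ _ _ _ _ (locally t) (near (setc v i (v i))) _ _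
    snd (fun z => setc v i (fst z)) shrink _ _ (@filterlim_shrink t _)).
    exact: (@continuous_snd R_UniformSpace R_UniformSpace).
  apply: filterlim_near => l; rewrite /setc; case: (l =P i) => _.
    exact: (@continuous_fst R_UniformSpace R_UniformSpace).
  exact: filterlim_const.
- by apply: filter_forall => s; apply: ex_RInt_integrand; apply: smooth_cont Hg.
Qed.

Lemma pd_cone a g i : smooth g -> pd i (cone a g) = cone (a + S i) (pd i g).
Proof. by move=> Hg; apply/is_pd_unique/is_pd_cone. Qed.

(** The induction must be general in [a], since each derivative may raise the weight. *)
Lemma smooth_cone a g : smooth g -> smooth (cone a g).
Proof.
move=> Hg k; elim: k a g Hg => [|k IH] a g Hg.
  exact: cont_cone (Hg O).
apply: CkS_intro => [|i|i]; first exact: cont_cone (Hg O).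
  exact: is_pd_cone.
by apply: IH; apply: smooth_pd.
Qed.

(* Integrate the derivative of [t ^ a.+1 * g (shrink t v)]. *)
Lemma euler_cone a g v : smooth g ->
  (\bigsum_i (radial v i * cone a.+1 (pd i g) v)) + INR a.+1 * cone a g v = g v.
Proof.
move=> Hg.
pose D t := (\bigsum_i (radial v i * (t ^ a.+1 * pd i g (shrink t v))))
  + INR a.+1 * (t ^ a * g (shrink t v)).
have HD t : is_derive (fun t => t ^ a.+1 * g (shrink t v)) t (D t).
  have H1 : is_derive (fun t => t ^ a.+1) t (INR a.+1 * t ^ a).
    by auto_derive => //; rewrite Rmult_1_l.
  have := @is_derive_mult R_AbsRing _ _ _ _ _ H1 (is_derive_shrink v t Hg) Rmult_comm.
  congr is_derive; rewrite /D /plus /mult /= Rplus_comm bigsum_mull; congr (_ + _).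
    by apply: eq_bigr => i _; ring.
  by rewrite Rmult_assoc.
have cD t : continuous D t.
  apply: filterlim_Rplus.
    apply: filterlim_bigsum => i; apply: filterlim_Rmult; first exact: filterlim_const.
    by apply: (@continuous_integrand a.+1); apply: smooth_cont (smooth_pd i Hg).
  apply: filterlim_Rmult; first exact: filterlim_const.
  by apply: continuous_integrand; apply: smooth_cont Hg.
have H1 := @is_RInt_derive R_CompleteNormedModule
  (fun t => t ^ a.+1 * g (shrink t v)) D 0 1 (fun t _ => HD t) (fun t _ => cD t).
have H2 : is_RInt D 0 1
    ((\bigsum_i (radial v i * cone a.+1 (pd i g) v)) + INR a.+1 * cone a g v).
  apply: (@is_RInt_plus R_NormedModule).
    apply: is_RInt_bigsum => i; apply: (@is_RInt_scal R_NormedModule).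
    apply: (@RInt_correct R_CompleteNormedModule); apply: (@ex_RInt_integrand a.+1).
    by apply: smooth_cont (smooth_pd i Hg).
  apply: (@is_RInt_scal R_NormedModule).
  apply: (@RInt_correct R_CompleteNormedModule); apply: ex_RInt_integrand.
  by apply: smooth_cont Hg.
rewrite -(is_RInt_unique _ _ _ _ H2) (is_RInt_unique _ _ _ _ H1).
(* The boundary term at [t = 0] vanishes since the exponent [a.+1] is positive; the one at [t = 1]
   is [g v]. *)
rewrite shrink1 pow1 pow_ne_zero // /minus /plus /opp /=; ring.
Qed.

Lemma cone_add a g h v : cont g -> cont h ->
  cone a (fun v => g v + h v) v = cone a g v + cone a h v.
Proof.
move=> Hg Hh.
apply: eq_trans (@RInt_plus R_CompleteNormedModule _ _ _ _
  (ex_RInt_integrand a v Hg) (ex_RInt_integrand a v Hh)).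
by apply: RInt_ext => t _; rewrite Rmult_plus_distr_l.
Qed.

(** Along the segment from [shrink 0 v] to [v] only the [S]-partials enter the derivative of [g]. *)
Lemma constant_of_pd0 g v : smooth g ->
  (forall i v, S i -> pd i g v = 0) -> g v = g (shrink 0 v).
Proof.
move=> Hg H0; rewrite -{1}(shrink1 v).
apply: esym; apply: (@eq_is_derive R_NormedModule (fun t => g (shrink t v)) 0 1).
  move=> t _; have := is_derive_shrink v t Hg.
  rewrite big1 // => i _; rewrite /radial.
  by case Si: (S i); [rewrite H0 // Rmult_0_r|rewrite Rmult_0_l].
exact: Rlt_0_1.
Qed.

Lemma smooth_radial j : smooth (fun v => radial v j).
Proof.
rewrite /radial; case: (S j); last exact: smooth_const.
by apply: smooth_sub; [apply: smooth_coord|apply: smooth_const].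
Qed.

Lemma pd_radial i j : S i ->
  pd i (fun v => radial v j) = fun _ => if j == i then 1 else 0.
Proof.
move=> Si; rewrite /radial; case Sj: (S j).
  rewrite pd_sub ?pd_coord ?pd_const; [|exact: smooth_coord|exact: smooth_const].
  by apply: functional_extensionality => v; rewrite Rminus_0_r.
rewrite pd_const; case: eqP => // ji; by rewrite ji Si in Sj.
Qed.

(** The homotopy operator of the Poincare lemma: contraction with the radial field followed by a
    cone integral, with [a = 0] for 1-forms and [a = 1] for the rows of 2-forms. Outside [S], where
    no smoothness of [G j] is assumed, zero is substituted; [radial] vanishes there. *)
Definition homotopy a (G : I -> (I -> R) -> R) v :=
  \bigsum_j (radial v j * cone a (if S j then G j else fun _ => 0) v).

Lemma smooth_homotopy a G : (forall j, S j -> smooth (G j)) -> smooth (homotopy a G).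
Proof.
move=> HG; apply: smooth_sum => j; apply: smooth_mul; first exact: smooth_radial.
by apply: smooth_cone; case: (boolP (S j)) => [/HG//|_]; apply: smooth_const.
Qed.

(** By the product rule, differentiating the radial factors leaves the single term [cone a (G i)],
    and differentiating the cone integrals raises their weight. *)
Lemma pd_homotopy a G i v : (forall j, S j -> smooth (G j)) -> S i ->
  pd i (homotopy a G) v =
  cone a (G i) v + \bigsum_j (radial v j * cone a.+1 (pd i (G j)) v).
Proof.
move=> HG Si.
have HG' j : smooth (if S j then G j else fun _ => 0).
  by case: (boolP (S j)) => [/HG//|_]; apply: smooth_const.
rewrite pd_sum => [|j]; last first.
  by apply: smooth_mul; [apply: smooth_radial|apply: smooth_cone].
rewrite -[X in _ = X + _](bigsum_delta (fun j => cone a (G j) v)) -bigsum_add.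
apply: eq_bigr => j _; rewrite pd_mul ?pd_radial ?pd_cone //;
  [|exact: smooth_radial|exact: smooth_cone].
rewrite Si addn1 /radial; case Sj: (S j); first by rewrite Rmult_comm.
case: eqP => [ji|_]; first by rewrite ji Si in Sj.
ring.
Qed.

(** Closedness turns [pd i (G j)] into [pd j (G i)] in [pd_homotopy], which then becomes the Euler
    identity of weight 0. The primitive vanishes at [shrink 0 v] because the radial field does. *)
Lemma poincare1 (G : I -> (I -> R) -> R) :
  (forall i, S i -> smooth (G i)) ->
  (forall i j v, S i -> S j -> pd i (G j) v = pd j (G i) v) ->
  exists H, smooth H /\ (forall i v, S i -> pd i H v = G i v) /\
    (forall v, H (shrink 0 v) = 0).
Proof.
move=> HG closed; exists (homotopy 0 G); split; first exact: smooth_homotopy.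
split=> [i v Si|v]; last first.
  by apply: big1 => j _; rewrite /radial /shrink; case: (S j); ring.
rewrite pd_homotopy // -(euler_cone 0 v (HG i Si)) /INR Rmult_1_l Rplus_comm.
congr (_ + _); apply: eq_bigr => j _; rewrite /radial; case Sj: (S j); last ring.
by congr (_ * cone _ _ _); apply: functional_extensionality => w; apply: closed.
Qed.

(** Take [A i = homotopy 1 (G i)]. In the difference of derivatives antisymmetry doubles
    [cone 1 (G i j)], and closedness reduces the sums to [radial v l * cone 2 (pd l (G i j))]. The
    result is the Euler identity of weight 1, whose coefficient [INR 2] is this doubling. *)
Lemma poincare2 (G : I -> I -> (I -> R) -> R) :
  (forall i j, S i -> S j -> smooth (G i j)) ->
  (forall i j v, S i -> S j -> G i j v + G j i v = 0) ->
  (forall i j l v, S i -> S j -> S l ->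
     pd l (G i j) v + pd i (G j l) v + pd j (G l i) v = 0) ->
  exists A, (forall i, S i -> smooth (A i)) /\
    (forall i j v, S i -> S j -> pd j (A i) v - pd i (A j) v = G i j v).
Proof.
move=> HG anti closed; exists (fun i => homotopy 1 (G i)).
have HG2 i : S i -> forall j, S j -> smooth (G i j) by move=> Si j; apply: HG.
split=> [i Si|i j v Si Sj]; first exact: smooth_homotopy (HG2 i Si).
rewrite !pd_homotopy //; try exact: HG2.
have swap i' j' : S i' -> S j' -> G i' j' = fun w => (-1) * G j' i' w.
  move=> Si' Sj'; apply: functional_extensionality => w.
  by have := anti i' j' w Si' Sj'; lra.
have E0 : cone 1 (G i j) v + cone 1 (G j i) v = 0.
  rewrite -cone_add; try by apply: smooth_cont; apply: HG.
  rewrite /cone (RInt_ext _ (fun _ => 0)) => [|t _]; last by rewrite anti // Rmult_0_r.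
  by rewrite RInt_const /scal /= /mult /= Rmult_0_r.
have E1 := euler_cone 1 v (HG i j Si Sj).
have E2 : \bigsum_l (radial v l * cone 2 (pd j (G i l)) v) =
    (\bigsum_l (radial v l * cone 2 (pd l (G i j)) v)) +
    \bigsum_l (radial v l * cone 2 (pd i (G j l)) v).
  rewrite -bigsum_add; apply: eq_bigr => l _; rewrite /radial; case Sl: (S l); last ring.
  rewrite -Rmult_plus_distr_l -cone_add; try by apply/smooth_cont/smooth_pd/HG.
  congr (_ * cone _ _ _); apply: functional_extensionality => w.
  have := closed i j l w Si Sj Sl; rewrite (swap l i) // pd_mul ?pd_const.
  - lra.
  - exact: smooth_const.
  - exact: HG.
rewrite E2; move: E1; rewrite /INR; lra.
Qed.

End Homotopy.

(** * Functions of [(x, w, p)] *)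

Section Jets.
Variable m : nat.

(** One finite index type for [x], [w] and [p] lets the preceding calculus treat all partial
    derivatives alike. *)
Definition jet : finType := option ('I_m + 'I_m)%type.
Definition X : jet := None.
Definition W (j : 'I_m) : jet := Some (inl j).
Definition P (j : 'I_m) : jet := Some (inr j).

Implicit Types (g : fun3 m) (G H : (jet -> R) -> R) (v : jet -> R) (x : R) (w p c : vec m)
  (i j k : 'I_m).

Definition pt x w p : jet -> R := fun l =>
  match l with None => x | Some (inl j) => w j | Some (inr j) => p j end.

(* Under this encoding [dx3], [dw3], [dp3] become [pd X], [pd (W j)], [pd (P j)]
   by mere conversion. *)
Definition up g : (jet -> R) -> R :=
  fun v => g (v X) (fun j => v (W j)) (fun j => v (P j)).

Definition down G : fun3 m := fun x w p => G (pt x w p).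

Definition ext2 (A : fun2 m) : (jet -> R) -> R := up (fun x w _ => A x w).

Definition slice c g : fun2 m := fun x w => g x w c.

Lemma pt_eta v : pt (v X) (fun j => v (W j)) (fun j => v (P j)) = v.
Proof. by apply: functional_extensionality => -[[j|j]|]. Qed.

Lemma upK G : up (down G) = G.
Proof. by apply: functional_extensionality => v; rewrite /up /down pt_eta. Qed.

Lemma up_dp j g : up (dp3 j g) = pd (P j) (up g). Proof. by []. Qed.

Lemma cont_up g : cont3 g <-> cont (up g).
Proof.
split=> [cg v Q [eps HQ]|cg x w p eps eps0].
  have [d [d0 Hd]] := cg (v X) (fun j => v (W j)) (fun j => v (P j)) eps (cond_pos eps).
  by exists (mkposreal d d0) => v' Hv; apply: HQ; apply: Hd => [|j|j]; apply: Hv.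
have [|d Hd] := cg (pt x w p) (fun y => Rabs (y - g x w p) < eps).
  by exists (mkposreal _ eps0).
exists d; split=> [|x' w' p' Hx Hw Hp]; first exact: cond_pos.
by apply: (Hd (pt x' w' p')) => -[[j|j]|] /=.
Qed.

Lemma Ck_up (k : nat) g : Ck3 k g <-> Ck k (up g).
Proof.
elim: k g => [|k IH] g; first exact: cont_up.
split=> [[cg [Hg [Hx [Hw Hp]]]]|[cg [Hg Hk]]].
  split; first exact/cont_up; split=> [l v|].
    have [H1 [H2 H3]] := Hg (v X) (fun j => v (W j)) (fun j => v (P j)).
    by case: l => [[j|j]|]; [apply: H2|apply: H3|apply: H1].
  case=> [[j|j]|]; [exact: (proj1 (IH _) (Hw j))|exact: (proj1 (IH _) (Hp j))|].
  exact: (proj1 (IH _) Hx).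
split; first exact/cont_up; split=> [x w p|].
  split; first exact: (Hg X (pt x w p)).
  by split=> j; [apply: (Hg (W j) (pt x w p))|apply: (Hg (P j) (pt x w p))].
split; first exact/IH/(Hk X).
by split=> j; apply/IH; [apply: (Hk (W j))|apply: (Hk (P j))].
Qed.

Lemma smooth_up g : smooth3 g <-> smooth (up g).
Proof. by split=> H k; apply/Ck_up/H. Qed.

Lemma smooth_down G : smooth G -> smooth3 (down G).
Proof. by move=> HG; apply/smooth_up; rewrite upK. Qed.

Lemma smooth_ext2 (A : fun2 m) : smooth2 A -> smooth (ext2 A).
Proof.
move=> HA k; elim: k A {HA}(HA k) => [|k IH] A.
  move=> cA v Q [eps HQ].
  have [d [d0 Hd]] := cA (v X) (fun j => v (W j)) eps (cond_pos eps).
  by exists (mkposreal d d0) => v' Hv; apply: HQ; apply: Hd => [|j]; apply: Hv.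
move=> [cA [HA [Hx Hw]]].
apply: (@CkS_intro _ k _ (fun l => match l with
  | None => ext2 (dx2 A) | Some (inl j) => ext2 (dw2 j A) | _ => fun _ => 0 end)).
- move=> v Q [eps HQ].
  have [d [d0 Hd]] := cA (v X) (fun j => v (W j)) eps (cond_pos eps).
  by exists (mkposreal d d0) => v' Hv; apply: HQ; apply: Hd => [|j]; apply: Hv.
- case=> [[j|j]|] v; last 2 first.
  + exact: (@is_derive_const R_AbsRing R_NormedModule (ext2 A v)).
  + have [[l Hl] _] := HA (v X) (fun j => v (W j)).
    move: (Hl) => /is_derive_Reals Hl'.
    by rewrite /ext2 /up /dx2 (deriv1_unique Hl').
  + have [_ /(_ j) [l Hl]] := HA (v X) (fun j => v (W j)).
    move: (Hl) => /is_derive_Reals Hl'.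
    by rewrite /ext2 /up /dw2 (deriv1_unique Hl').
- by case=> [[j|j]|]; [apply: (IH _ (Hw j))|apply: Ck_const|apply: (IH _ Hx)].
Qed.

Lemma smooth_slice c g : smooth3 g -> smooth2 (slice c g).
Proof.
move=> Hg k; elim: k g {Hg}(Hg k) => [|k IH] g.
  move=> cg x w eps eps0; have [d [d0 Hd]] := cg x w c eps eps0.
  exists d; split=> // x' w' Hx Hw; apply: Hd => // j.
  by rewrite Rminus_diag Rabs_R0.
move=> [cg [Hg [Hx [Hw _]]]]; split.
  move=> x w eps eps0; have [d [d0 Hd]] := cg x w c eps eps0.
  exists d; split=> // x' w' Hx' Hw'; apply: Hd => // j.
  by rewrite Rminus_diag Rabs_R0.
split; first by move=> x w; have [? []] := Hg x w c.
by split=> [|j]; [apply: (IH _ Hx)|apply: (IH _ (Hw j))].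
Qed.

Lemma pd_ext2_p j (A : fun2 m) : pd (P j) (ext2 A) = fun _ => 0.
Proof.
apply: is_pd_unique => v.
exact: (@is_derive_const R_AbsRing R_NormedModule (ext2 A v)).
Qed.

Lemma eq_up g G : (forall x w p, g x w p = G (pt x w p)) -> up g = G.
Proof.
by move=> H; apply: functional_extensionality => v; rewrite /up H pt_eta.
Qed.

Let isP : pred jet := fun l => if l is Some (inr _) then true else false.
Let isW : pred jet := fun l => if l is Some (inl _) then true else false.

(** Since [isP] scales only the [p]-coordinates, the entries for [x] and [w] in the base point
    [pt 0 c c] are fillers. *)
Lemma shrink_p c v : shrink isP (pt 0 c c) 0 v = pt (v X) (fun j => v (W j)) c.
Proof. by apply: functional_extensionality => -[[j|j]|]; rewrite /shrink //=; ring. Qed.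

Lemma constant_p c G v : smooth G -> (forall j v, pd (P j) G v = 0) ->
  G v = G (pt (v X) (fun j => v (W j)) c).
Proof.
move=> HG H; rewrite (@constant_of_pd0 _ isP (pt 0 c c) _ v HG) ?shrink_p //.
by case=> [[j|j]|] // v' _; apply: H.
Qed.

Lemma zero_p c G v : smooth G -> (forall j v, pd (P j) G v = 0) ->
  (forall x w, G (pt x w c) = 0) -> G v = 0.
Proof. by move=> HG H1 H0; rewrite (@constant_p c G v HG H1) H0. Qed.

(** [zero_p] is applied to each first [p]-derivative of [G], then to [G] itself. *)
Lemma zero_pp c G v : smooth G ->
  (forall i j v, pd (P j) (pd (P i) G) v = 0) ->
  (forall x w, G (pt x w c) = 0) -> (forall j x w, pd (P j) G (pt x w c) = 0) -> G v = 0.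
Proof.
move=> HG H2 H0 H1; apply: (@zero_p c G v HG) => // j v'.
exact: (@zero_p c _ v' (smooth_pd (P j) HG)).
Qed.

(** [poincare1] in the [p]-directions with [x] and [w] as parameters; the components outside the
    block are filled with zero. *)
Lemma poincare1_p c (G : 'I_m -> (jet -> R) -> R) :
  (forall j, smooth (G j)) -> (forall i j v, pd (P i) (G j) v = pd (P j) (G i) v) ->
  exists H, smooth H /\ (forall j v, pd (P j) H v = G j v) /\
    (forall x w, H (pt x w c) = 0).
Proof.
move=> HG closed.
have [||H [sH [dH H0]]] := @poincare1 jet isP (pt 0 c c)
  (fun l => if l is Some (inr j) then G j else fun _ => 0).
- by case=> [[j|j]|] // _; apply: HG.
- by case=> [[i|i]|] // [[j|j]|] // v _ _; apply: closed.
exists H; split=> //; split=> [j v|x w]; first exact: (dH (P j)).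
by have := H0 (pt x w c); rewrite shrink_p.
Qed.

Lemma poincare1_w (G : 'I_m -> (jet -> R) -> R) :
  (forall j, smooth (G j)) -> (forall i j v, pd (W i) (G j) v = pd (W j) (G i) v) ->
  exists H, smooth H /\ (forall j v, pd (W j) H v = G j v).
Proof.
move=> HG closed.
have [||H [sH [dH _]]] := @poincare1 jet isW (fun _ => 0)
  (fun l => if l is Some (inl j) then G j else fun _ => 0).
- by case=> [[j|j]|] // _; apply: HG.
- by case=> [[i|i]|] // [[j|j]|] // v _ _; apply: closed.
by exists H; split=> // j v; apply: (dH (W j)).
Qed.

Lemma poincare2_w (G : 'I_m -> 'I_m -> (jet -> R) -> R) :
  (forall i j, smooth (G i j)) -> (forall i j v, G i j v + G j i v = 0) ->
  (forall i j k v,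
     pd (W k) (G i j) v + pd (W i) (G j k) v + pd (W j) (G k i) v = 0) ->
  exists A : 'I_m -> (jet -> R) -> R, (forall i, smooth (A i)) /\
    (forall i j v, pd (W j) (A i) v - pd (W i) (A j) v = G i j v).
Proof.
move=> HG anti closed.
have [|||A [sA dA]] := @poincare2 jet isW (fun _ => 0) (fun l l' =>
  if l is Some (inl i) then if l' is Some (inl j) then G i j else fun _ => 0
  else fun _ => 0).
- by case=> [[i|i]|] // [[j|j]|] // _ _; apply: HG.
- by case=> [[i|i]|] // [[j|j]|] // v _ _; apply: anti.
- by case=> [[i|i]|] // [[j|j]|] // [[k|k]|] // v _ _ _; apply: closed.
exists (fun j => A (W j)); split=> [i|i j v]; first exact: sA.
exact: (dA (W i) (W j)).
Qed.

End Jets.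

(** * The inverse problem *)

Ltac smoothness := repeat
  (match goal with |- forall _, _ => intro end || assumption ||
   apply: smooth_const || apply: smooth_coord || apply: smooth_mul ||
   apply: smooth_sub || apply: smooth_add || apply: smooth_sum || apply: smooth_pd).

Lemma dependent_choice (T U : Type) (Q : T -> U -> Prop) :
  (forall t, exists u, Q t u) -> exists f, forall t, Q t (f t).
Proof.
move=> H; exists (fun t => proj1_sig (constructive_indefinite_description _ (H t))) => t.
exact: proj2_sig.
Qed.

(** * The Euler operator and the curl of the momenta *)

Section EulerOperator.
Variable m : nat.
Implicit Types (f G : (jet m -> R) -> R) (v : jet m -> R) (i j k : 'I_m).

(* [e^j[f]] without its second-order terms. *)
Definition euler j f : (jet m -> R) -> R := fun v =>
  pd (W j) f v - pd (X m) (pd (P j) f) v - \bigsum_k (pd (W k) (pd (P j) f) v * v (P k)).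

(** The curl in [w] of the momenta [a_i = f_{p^i}]; for a solution it is [Phi^{ij}]. *)
Definition cross i j f : (jet m -> R) -> R := fun v =>
  pd (W j) (pd (P i) f) v - pd (W i) (pd (P j) f) v.

Lemma smooth_euler j f : smooth f -> smooth (euler j f).
Proof. by move=> Hf; rewrite /euler; smoothness. Qed.

Lemma smooth_cross i j f : smooth f -> smooth (cross i j f).
Proof. by move=> Hf; rewrite /cross; smoothness. Qed.

(** Differentiating the explicit factor [p^k] in the sum yields [- d_{w^i} a_j], which joins
    [d_{w^j} a_i] to form [cross]. *)
Lemma pd_p_euler i j f v : smooth f ->
  pd (P i) (euler j f) v = cross i j f v - pd (X m) (pd (P i) (pd (P j) f)) v
    - \bigsum_k (pd (W k) (pd (P i) (pd (P j) f)) v * v (P k)).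
Proof.
move=> Hf; rewrite /euler pd_sub; [|by smoothness..].
rewrite pd_sub; [|by smoothness..].
rewrite pd_sum => [|k]; last by smoothness.
rewrite (pd_comm (P i) (X m)); last by smoothness.
rewrite (eq_bigr (fun k => pd (W k) (pd (P i) (pd (P j) f)) v * v (P k)
    + pd (W k) (pd (P j) f) v * (if k == i then 1 else 0))) => [|k _].
  rewrite bigsum_add bigsum_delta /cross (pd_comm (W j) (P i) Hf); ring.
rewrite pd_mul ?pd_coord; [|by smoothness..].
by rewrite (pd_comm (P i) (W k)); last by smoothness.
Qed.

Lemma pd_w_euler i j f v : smooth f ->
  pd (W i) (euler j f) v = pd (W i) (pd (W j) f) v - pd (X m) (pd (W i) (pd (P j) f)) v
    - \bigsum_k (pd (W k) (pd (W i) (pd (P j) f)) v * v (P k)).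
Proof.
move=> Hf; rewrite /euler pd_sub; [|by smoothness..].
rewrite pd_sub; [|by smoothness..].
rewrite pd_sum => [|k]; last by smoothness.
rewrite (pd_comm (W i) (X m)); last by smoothness.
congr (_ - _); apply: eq_bigr => k _.
rewrite pd_mul ?pd_coord; [|by smoothness..].
rewrite (pd_comm (W i) (W k)); last by smoothness.
by rewrite /= Rmult_0_r Rplus_0_r.
Qed.

Lemma pd_cross i j f l v : smooth f -> pd l (cross i j f) v =
  pd (W j) (pd l (pd (P i) f)) v - pd (W i) (pd l (pd (P j) f)) v.
Proof.
move=> Hf; rewrite /cross pd_sub; [|by smoothness..].
by rewrite (pd_comm l (W j)) ?(pd_comm l (W i)); smoothness.
Qed.

End EulerOperator.

(** * Necessity of the conditions, and construction of all solutions *)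

Section Inverse.
Variables (m : nat) (F2 : 'I_m -> 'I_m -> fun3 m) (F1 : 'I_m -> fun3 m) (c : vec m).
Hypotheses (HF2s : forall j j', smooth3 (F2 j j'))
  (HF2sym : forall j j' x w p, F2 j j' x w p = F2 j' j x w p)
  (HF1s : forall j, smooth3 (F1 j)).

Local Notation solution := (is_solution F2 F1).
Local Notation Phi := (Phi F2 F1).
Local Notation phi := (phi F2 F1 c).
Local Notation psi := (psi F1 c).

Lemma smooth_F2 i j : smooth (up (F2 i j)).
Proof. exact/smooth_up. Qed.

Lemma smooth_F1 j : smooth (up (F1 j)).
Proof. exact/smooth_up. Qed.

Lemma up_Phi i j : up (Phi i j) = fun v =>
  pd (P i) (up (F1 j)) v + pd (X m) (up (F2 j i)) v
  + \bigsum_k (pd (W k) (up (F2 j i)) v * v (P k)).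
Proof. by []. Qed.

Lemma smooth_Phi i j : smooth3 (Phi i j).
Proof.
have s1 := smooth_F1 j; have s2 := smooth_F2 j i.
by apply/smooth_up; rewrite up_Phi; smoothness.
Qed.

Lemma solution_up f : solution f <-> [/\ smooth (up f),
  (forall j j', pd (P j') (pd (P j) (up f)) = up (F2 j j')) &
  (forall j, euler j (up f) = up (F1 j))].
Proof.
split=> [[sf [H2 H1]]|[sf H2 H1]].
  split; first exact/smooth_up.
    by move=> j j'; apply: functional_extensionality => v;
      exact: (H2 j j' (v (X m)) (fun k => v (W k)) (fun k => v (P k))).
  by move=> j; apply: functional_extensionality => v;
    exact: (H1 j (v (X m)) (fun k => v (W k)) (fun k => v (P k))).
split; first exact/smooth_up; split=> [j j'|j] x w p.
  exact: (congr1 (fun G => G (pt x w p)) (H2 j j')).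
exact: (congr1 (fun G => G (pt x w p)) (H1 j)).
Qed.

(** With [F^j] replaced by [euler j f], the [x]- and [w]-derivatives of [F^{ji}] in [Phi] cancel
    those of [pd_p_euler]. *)
Lemma Phi_solution f i j : solution f -> up (Phi i j) = cross i j (up f).
Proof.
move=> /solution_up[sf H2 H1]; apply: functional_extensionality => v.
rewrite up_Phi -H1 pd_p_euler // H2; ring.
Qed.

Lemma solution_conditions f : solution f -> conditions F2 F1 c.
Proof.
move=> Hf; have HPhi i j := Phi_solution i j Hf.
have /solution_up[sf H2 H1] := Hf.
have EPhi i j x w p : Phi i j x w p = cross i j (up f) (pt x w p).
  exact: (congr1 (fun G => G (pt x w p)) (HPhi i j)).
(* Condition (a) is the symmetry of third [p]-derivatives, (b) the antisymmetry of [cross], and (c)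
   the [p]-derivative of [cross]. *)
split=> [j j' j'' x w p|].
  have E (a b d : 'I_m) : dp3 a (F2 b d) x w p =
      pd (P a) (pd (P d) (pd (P b) (up f))) (pt x w p) by rewrite H2.
  by rewrite !E pd_comm //; smoothness.
split=> [j j' x w p|].
  by rewrite !EPhi /cross; ring.
split=> [j j' j'' x w p|].
  have -> : dp3 j'' (Phi j' j) x w p = pd (P j'') (up (Phi j' j)) (pt x w p) by [].
  by rewrite HPhi pd_cross // !H2.
split=> [j j' k x w|j j' x w].
  (* Condition (d) says that a curl is closed: the second [w]-derivatives of the momenta cancel in
     pairs. *)
  have E (a i b : 'I_m) : dw2 a (phi i b) x w = pd (W a) (up (Phi i b)) (pt x w c) by [].
  rewrite !E !HPhi !pd_cross //.
  have cm a b d : pd (W a) (pd (W b) (pd (P d) (up f))) = pd (W b) (pd (W a) (pd (P d) (up f))).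
    by apply: pd_comm; smoothness.
  by rewrite (cm j k) (cm j' k) (cm j j'); ring.
(* Condition (e) is the [w]-curl of the Euler equation at [p = c]: the second [w]-derivatives of [f]
   cancel, and what remains is minus [d_x + sum_k c^k d_{w^k}] applied to [cross j' j]. *)
have E (a b : 'I_m) : dw2 a (psi b) x w = pd (W a) (up (F1 b)) (pt x w c) by [].
have Ex : dx2 (phi j' j) x w = pd (X m) (up (Phi j' j)) (pt x w c) by [].
have Ew k : dw2 k (phi j' j) x w = pd (W k) (up (Phi j' j)) (pt x w c) by [].
rewrite /sumI (eq_bigr (fun k =>
     pd (W k) (pd (W j) (pd (P j') (up f))) (pt x w c) * c k
   - pd (W k) (pd (W j') (pd (P j) (up f))) (pt x w c) * c k)) => [|k _].
  rewrite bigsum_sub !E Ex -!H1 !pd_w_euler // HPhi pd_cross //.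
  rewrite (pd_comm (W j) (W j') sf) (pd_comm (X m) (W j)) ?(pd_comm (X m) (W j')) /=;
    [ring|by smoothness..].
rewrite Ew HPhi pd_cross // (pd_comm (W k) (W j)) ?(pd_comm (W k) (W j'));
  [ring|by smoothness..].
Qed.

Lemma fbar_up fb : is_fbar F2 c fb <-> [/\ smooth (up fb),
  (forall j j', pd (P j') (pd (P j) (up fb)) = up (F2 j j')),
  (forall x w, up fb (pt x w c) = 0) & (forall j x w, pd (P j) (up fb) (pt x w c) = 0)].
Proof.
split=> [[sf [H2 [H0 H1]]]|[sf H2 H0 H1]].
  split=> //; first exact/smooth_up.
  by move=> j j'; apply: functional_extensionality => v;
      exact: (H2 j j' (v (X m)) (fun k => v (W k)) (fun k => v (P k))).
split; first exact/smooth_up; split=> // j j' x w p.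
exact: (congr1 (fun G => G (pt x w p)) (H2 j j')).
Qed.

Lemma fbar_unique fb1 fb2 : is_fbar F2 c fb1 -> is_fbar F2 c fb2 ->
  forall x w p, fb1 x w p = fb2 x w p.
Proof.
move=> /fbar_up[s1 H2 H0 H1] /fbar_up[s2 H2' H0' H1'] x w p.
apply: Rminus_diag_uniq.
apply: (@zero_pp m c (fun v => up fb1 v - up fb2 v) (pt x w p)).
- by smoothness.
- move=> i j v; rewrite pd_sub // pd_sub ?H2 ?H2'; [ring|by smoothness..].
- by move=> x' w'; rewrite H0 H0'; ring.
- by move=> j x' w'; rewrite pd_sub // H1 H1'; ring.
Qed.

(** By (a) each row [F2 j] is a closed 1-form in [p], with a primitive [D j]; the symmetry of [F2]
    then makes [D] closed. Both primitives are normalised to vanish at [p = c]. *)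
Lemma fbar_exists : conditions F2 F1 c -> exists fb, is_fbar F2 c fb.
Proof.
move=> [Ha _].
have Hd j : exists H, smooth H /\ (forall j' v, pd (P j') H v = up (F2 j j') v) /\
    (forall x w, H (pt x w c) = 0).
  apply: poincare1_p => [j'|i j' v]; first exact: smooth_F2.
  exact: (Ha j j' i (v (X m)) (fun k => v (W k)) (fun k => v (P k))).
have [D HD] := dependent_choice Hd.
have [||f [sf [df f0]]] := @poincare1_p m c D.
- by move=> j; have [] := HD j.
- move=> i j v; have [_ [-> _]] := HD j; have [_ [-> _]] := HD i.
  exact: HF2sym.
exists (down f); apply/fbar_up; rewrite upK.
have df' j : pd (P j) f = D j by apply: functional_extensionality => v; apply: df.
split=> // [j j'|j x w]; rewrite df'; have [_ [H0 H1]] := HD j => //.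
by apply: functional_extensionality => v; apply: H0.
Qed.

Definition affine (A1 : 'I_m -> fun2 m) (A : fun2 m) : (jet m -> R) -> R := fun v =>
  (\bigsum_j (ext2 (A1 j) v * (v (P j) - c j))) + ext2 A v.

Lemma smooth_affine A1 A : (forall j, smooth2 (A1 j)) -> smooth2 A -> smooth (affine A1 A).
Proof.
move=> s1 s; have s1' j := smooth_ext2 (s1 j); have s' := smooth_ext2 s.
by rewrite /affine; apply: smooth_add => //; apply: smooth_sum => j;
  apply: smooth_mul => //; smoothness.
Qed.

Lemma pd_p_affine A1 A i : (forall j, smooth2 (A1 j)) -> smooth2 A ->
  pd (P i) (affine A1 A) = ext2 (A1 i).
Proof.
move=> s1 s; have s1' j := smooth_ext2 (s1 j); have s' := smooth_ext2 s.
have sm j : smooth (fun v : jet m -> R => ext2 (A1 j) v * (v (P j) - c j)).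
  by apply: smooth_mul => //; smoothness.
apply: functional_extensionality => v.
rewrite /affine pd_add ?pd_sum //; last exact: smooth_sum.
rewrite pd_ext2_p Rplus_0_r -(bigsum_delta (fun j => ext2 (A1 j) v)).
apply: eq_bigr => j _; rewrite pd_mul //; last by smoothness.
rewrite pd_ext2_p pd_sub ?pd_coord ?pd_const; [|by smoothness..].
by rewrite Rmult_0_l Rplus_0_l Rminus_0_r.
Qed.

Lemma affine_base A1 A x w : affine A1 A (pt x w c) = A x w.
Proof. by rewrite /affine big1 => [|j _] /=; [rewrite Rplus_0_l|ring]. Qed.

(** The coefficients are the Taylor data of [f] at [p = c]: its value and its first [p]-derivatives.
    Their equations are [Phi_solution] and the Euler equation restricted to [p = c], and [zero_pp]
    identifies [f] with the resulting expression. *)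
Lemma solution_form fb f : is_fbar F2 c fb -> solution f -> of_stated_form F2 F1 c fb f.
Proof.
move=> /fbar_up[sb B2 B0 B1] Hf; have HPhi i j := Phi_solution i j Hf.
have /solution_up[sf H2 H1] := Hf.
pose A1 j := slice c (dp3 j f); pose A := slice c f.
have sA1 j : smooth2 (A1 j).
  by apply/smooth_slice/smooth_up; rewrite up_dp; smoothness.
have sA : smooth2 A by apply/smooth_slice/smooth_up.
exists A1, A; split=> //; split=> //; split=> [j j' x w|].
  by rewrite -[RHS]/(up (Phi j' j) (pt x w c)) HPhi.
split=> [j x w|x w p].
  rewrite -[psi j x w]/(up (F1 j) (pt x w c)) -H1 /euler.
  rewrite -[dw2 j A x w]/(pd (W j) (up f) (pt x w c)).
  rewrite -[dx2 (A1 j) x w]/(pd (X m) (pd (P j) (up f)) (pt x w c)).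
  have -> : sumI (fun k => c k * dw2 k (A1 j) x w) =
      \bigsum_k (pd (W k) (pd (P j) (up f)) (pt x w c) * pt x w c (P k)).
    by apply: eq_bigr => k _; rewrite Rmult_comm.
  ring.
have sa := smooth_affine sA1 sA.
suff : up f (pt x w p) - (up fb (pt x w p) + affine A1 A (pt x w p)) = 0.
  by move/Rminus_diag_uniq => E; rewrite Rplus_assoc; exact: E.
have sAe j := smooth_ext2 (sA1 j).
have dg i : pd (P i) (fun v => up f v - (up fb v + affine A1 A v)) =
    fun v => pd (P i) (up f) v - (pd (P i) (up fb) v + ext2 (A1 i) v).
  by rewrite pd_sub ?(@pd_add _ _ (up fb)) ?pd_p_affine //; smoothness.
have sbA i : smooth (fun v => pd (P i) (up fb) v + ext2 (A1 i) v).
  by apply: smooth_add => //; smoothness.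
apply: (@zero_pp m c (fun v => up f v - (up fb v + affine A1 A v)) (pt x w p)).
- by smoothness.
- move=> i j v; rewrite dg pd_sub ?pd_add ?H2 ?B2 ?pd_ext2_p //;
    [by apply: Rminus_diag_eq; rewrite Rplus_0_r|by smoothness..].
- by move=> x' w'; apply: Rminus_diag_eq; rewrite B0 affine_base Rplus_0_l.
- move=> j x' w'; rewrite dg B1 -up_dp.
  by apply: Rminus_diag_eq; rewrite Rplus_0_l.
Qed.

Lemma form_solution fb f : conditions F2 F1 c -> is_fbar F2 c fb ->
  of_stated_form F2 F1 c fb f -> solution f.
Proof.
move=> [_ [_ [Hc _]]] /fbar_up[sb B2 B0 B1] [A1 [A [sA1 [sA [R1 [R0 Hf]]]]]].
have sa := smooth_affine sA1 sA.
have Ef : up f = fun v => up fb v + affine A1 A v.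
  by apply: eq_up => x w p; rewrite Hf Rplus_assoc.
have sf : smooth (up f) by rewrite Ef; smoothness.
have dpf j : pd (P j) (up f) = fun v => pd (P j) (up fb) v + ext2 (A1 j) v.
  by rewrite Ef pd_add // pd_p_affine.
have H2 j j' : pd (P j') (pd (P j) (up f)) = up (F2 j j').
  rewrite dpf pd_add ?B2 ?pd_ext2_p; [|by smoothness|exact: smooth_ext2].
  by apply: functional_extensionality => v; rewrite Rplus_0_r.
(* Recovering [A] and [A1] as the Taylor data of [f] at [p = c] turns their equations into
   statements about [f]. *)
have fA : slice c f = A.
  apply: functional_extensionality => x; apply: functional_extensionality => w.
  by rewrite -[LHS]/(up f (pt x w c)) Ef B0 affine_base Rplus_0_l.
have fA1 j : slice c (dp3 j f) = A1 j.
  apply: functional_extensionality => x; apply: functional_extensionality => w.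
  by rewrite -[LHS]/(pd (P j) (up f) (pt x w c)) dpf B1 Rplus_0_l.
apply/solution_up; split=> // j; apply: functional_extensionality => v.
have sP i l : smooth (up (Phi i l)) by apply/smooth_up/smooth_Phi.
have s1 l := smooth_F1 l.
have sE l := smooth_euler l sf.
have sC i l := smooth_cross i l sf.
(* First use of [zero_p]: the [p]-derivatives of [cross] and [Phi] agree by (c), their values at
   [p = c] by the equation for [A1]. *)
have cross_Phi i l v' : cross i l (up f) v' = up (Phi i l) v'.
  apply: Rminus_diag_uniq; apply: (@zero_p m c (fun v => cross i l (up f) v - up (Phi i l) v)).
  - exact: smooth_sub.
  - move=> k u; rewrite pd_sub // pd_cross // !H2.
    apply: Rminus_diag_eq; symmetry.
    exact: (Hc l i k (u (X m)) (fun a => u (W a)) (fun a => u (P a))).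
  - move=> x w; have := R1 l i x w; rewrite -!fA1.
    by move=> H; apply: Rminus_diag_eq.
(* Second use: the [p]-derivatives of the Euler defect are [cross - Phi], now known to vanish, and
   its value at [p = c] vanishes by the equation for [A]. *)
apply: Rminus_diag_uniq; apply: (@zero_p m c (fun v => euler j (up f) v - up (F1 j) v)).
- exact: smooth_sub.
- by move=> k u; rewrite pd_sub // pd_p_euler // H2 cross_Phi up_Phi; ring.
- move=> x w; have := R0 j x w; rewrite -fA1 -fA.
  rewrite -[psi j x w]/(up (F1 j) (pt x w c)).
  rewrite -[dw2 j _ x w]/(pd (W j) (up f) (pt x w c)).
  rewrite -[dx2 _ x w]/(pd (X m) (pd (P j) (up f)) (pt x w c)).
  rewrite /euler => ->.
  have -> : sumI (fun k => c k * dw2 k (slice c (dp3 j f)) x w) =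
      \bigsum_k (pd (W k) (pd (P j) (up f)) (pt x w c) * pt x w c (P k)).
    by apply: eq_bigr => k _; rewrite Rmult_comm.
  ring.
Qed.

Lemma coefficients_exist : conditions F2 F1 c -> exists (A1 : 'I_m -> fun2 m) (A : fun2 m),
  (forall j, smooth2 (A1 j)) /\ smooth2 A /\
  (forall j j' x w, dw2 j (A1 j') x w - dw2 j' (A1 j) x w = phi j' j x w) /\
  (forall j x w, dw2 j A x w =
     psi j x w + dx2 (A1 j) x w + sumI (fun k => c k * dw2 k (A1 j) x w)).
Proof.
move=> [_ [Hb [_ [Hd He]]]].
have sphi i j : smooth (ext2 (phi i j)).
  apply: smooth_ext2; exact: (@smooth_slice m c _ (smooth_Phi i j)).
have spsi j : smooth (ext2 (psi j)) 
  by apply: smooth_ext2; exact: (@smooth_slice m c _ (HF1s j)).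
have [|||H [sH dH]] := @poincare2_w m (fun i j => ext2 (phi i j)) => //.
- by move=> i j v; apply: (Hb j i _ _ c).
- by move=> i j k v; apply: (Hd j i k).
(* The primitive [H j] lives on the whole jet space; freezing [p = c] makes it a function of
   [(x, w)] and commutes with [w]-derivatives. *)
pose A1 j := slice c (down (H j)).
have sA1 j : smooth2 (A1 j) by apply/smooth_slice/smooth_down.
have sB j := smooth_ext2 (sA1 j).
have EA a b x w : dw2 a (A1 b) x w = pd (W a) (H b) (pt x w c).
  by rewrite -(upK (H b)).
have R1 j j' x w : dw2 j (A1 j') x w - dw2 j' (A1 j) x w = phi j' j x w.
  by rewrite !EA dH.
(* [G] is the prescribed [w]-differential of [A]. *)
pose G j := fun v => ext2 (psi j) v + pd (X m) (ext2 (A1 j)) v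
  + \bigsum_k (c k * pd (W k) (ext2 (A1 j)) v).
have sG j : smooth (G j) by rewrite /G; have := sB j; have := spsi j => ? ?; smoothness.
have EG i j v : pd (W i) (G j) v = pd (W i) (ext2 (psi j)) v
    + pd (X m) (pd (W i) (ext2 (A1 j))) v
    + \bigsum_k (c k * pd (W k) (pd (W i) (ext2 (A1 j))) v).
  have sBj := sB j; have spj := spsi j.
  rewrite /G pd_add ?pd_add ?pd_sum; [|by smoothness..].
  rewrite (pd_comm (W i) (X m)) //; congr (_ + _); apply: eq_bigr => k _.
  rewrite pd_mul ?pd_const ?(pd_comm (W i) (W k)); [ring|by smoothness..].
(* With [phi] written as the curl of [A1], condition (e) is exactly the closedness of [G]. *)
have closedG i j v : pd (W i) (G j) v = pd (W j) (G i) v.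
  have Ephi : ext2 (phi j i) = fun v => pd (W i) (ext2 (A1 j)) v - pd (W j) (ext2 (A1 i)) v.
    by apply: functional_extensionality => u; rewrite /ext2 /up -R1.
  have sBj := sB j; have sBi := sB i.
  have dphi l : pd l (ext2 (phi j i)) v =
      pd l (pd (W i) (ext2 (A1 j))) v - pd l (pd (W j) (ext2 (A1 i))) v.
    by rewrite Ephi pd_sub; smoothness.
  have E : pd (W i) (ext2 (psi j)) v - pd (W j) (ext2 (psi i)) v
      + pd (X m) (ext2 (phi j i)) v + (\bigsum_k (c k * pd (W k) (ext2 (phi j i)) v)) = 0.
    exact: (He i j (v (X m)) (fun k => v (W k))).
  move: E; rewrite dphi (eq_bigr (fun k => c k * pd (W k) (pd (W i) (ext2 (A1 j))) v
    - c k * pd (W k) (pd (W j) (ext2 (A1 i))) v)) => [|k _]; last by rewrite dphi; ring.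
  rewrite bigsum_sub !EG; lra.
have [K [sK dK]] := poincare1_w sG closedG.
exists A1, (slice c (down K)); split=> //; split; first exact/smooth_slice/smooth_down.
split=> // j x w.
have -> : dw2 j (slice c (down K)) x w = pd (W j) K (pt x w c) by rewrite -{2}(upK K).
by rewrite dK.
Qed.

End Inverse.

Theorem theorem4p1 (m : nat) (F2 : 'I_m -> 'I_m -> fun3 m) (F1 : 'I_m -> fun3 m)
  (c : vec m)
  (HF2s : forall j j', smooth3 (F2 j j'))
  (HF2sym : forall j j' x w p, F2 j j' x w p = F2 j' j x w p)
  (HF1s : forall j, smooth3 (F1 j)) :
  ((exists f, is_solution F2 F1 f) <-> conditions F2 F1 c) /\
  (conditions F2 F1 c ->
     (exists fb, is_fbar F2 c fb) /\
     (forall fb1 fb2, is_fbar F2 c fb1 -> is_fbar F2 c fb2 ->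
        forall x w p, fb1 x w p = fb2 x w p) /\
     (forall fb, is_fbar F2 c fb ->
        forall f, is_solution F2 F1 f <-> of_stated_form F2 F1 c fb f)).
Proof.
split; last first.
  move=> Hcond; split; first exact: fbar_exists HF2s HF2sym Hcond.
  split=> [fb1 fb2|fb Hfb f]; first exact: fbar_unique.
  split=> [Hf|Hf]; first exact: solution_form Hfb Hf.
  exact (form_solution HF2s HF1s Hcond Hfb Hf).
split=> [[f]|Hcond]; first exact: solution_conditions.
have [fb Hfb] := fbar_exists HF2s HF2sym Hcond.
have [A1 [A [sA1 [sA [R1 R0]]]]] := coefficients_exist HF2s HF1s Hcond.
(* Any admissible coefficients added to [fb] give a function of the stated form, hence a
   solution. *)
exists (fun x w p => fb x w p + sumI (fun j => A1 j x w * (p j - c j)) + A x w).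
by apply: (form_solution HF2s HF1s Hcond Hfb); exists A1, A.
Qed.
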